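(* Let $G$ be a finite group and $S$ a union of conjugacy classes of $G$ with $1 \notin S$ and $S^{-1} = S$. Let $H$ be a subgroup of $G$ such that $\sum_{K} \frac{|K|\chi(K)}{d_\chi} \neq 0$ for every irreducible complex character $\chi$ of $G$ occurring as a constituent in the decomposition of $\lambda_G^H$ into irreducible characters, where $K$ runs over all conjugacy classes of $G$ contained in $S$. Then every total perfect code in $\mathrm{Cay}(G, S)$ intersects every left coset of $H$ in $G$ in exactly $|H|/|S|$ elements. In particular, if $|S|$ does not divide $|H|$, then $\mathrm{Cay}(G, S)$ has no total perfect code.
   Context: The Cayley graph $\mathrm{Cay}(G,S)$ has vertex set $G$, with $x, y$ adjacent iff $xy^{-1} \in S$. A total perfect code in a graph is a set $C$ of vertices such that every vertex is adjacent to exactly one vertex of $C$. For a character $\chi$, $d_\chi = \chi(1)$ is its degree, and $\chi(K)$ denotes $\chi(x)$ for any $x$ in the conjugacy class $K$. If $x_1H, \ldots, x_mH$ are the left cosets of $H$ in $G$ ($m = |G:H|$), $\lambda_G^H$ is the permutation representation of $G$ of degree $m$ on the space with basis $\{\delta_{x_1H}, \ldots, \delta_{x_mH}\}$ given by $\lambda_G^H(g)(\delta_{x_iH}) = \delta_{gx_iH}$ (the permutation representation of $G$ on the left cosets of $H$). *)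

(* Defs.v *)
From HB Require Import structures.
From mathcomp Require Import all_boot all_order all_algebra.
From mathcomp Require Import all_fingroup all_solvable all_field all_character.

Set Implicit Arguments.
Unset Strict Implicit.
Unset Printing Implicit Defensive.

Import GRing.Theory.
Local Open Scope ring_scope.

Definition cayley (gT : finGroupType) (S : {set gT}) : rel gT :=
  fun x y => (x * y^-1)%g \in S.

(* [e] is the adjacency relation of a graph with vertex set [V]. *)
Definition total_perfect_code (T : finType) (V : {set T}) (e : rel T)
    (C : {set T}) : Prop :=
  C \subset V /\ {in V, forall x, #|[set c in C | e x c]| = 1%N}.

Definition union_of_classes (gT : finGroupType) (G : {group gT})
    (S : {set gT}) : Prop :=
  exists2 P : {set {set gT}}, P \subset classes G & S = cover P.

Section CosetRepresentation.

Variables (gT : finGroupType) (G H : {group gT}).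

(* The index [i] stands for the basis vector of the i-th left coset. Column j
   of the matrix is the image of basis vector j, so the matrices act on column
   vectors; they still compose as [mx_repr] requires. *)
Definition lcoset_mx (g : gT) : 'M[algC]_#|lcosets H G| :=
  \matrix_(i, j) (enum_val i == g *: enum_val j :> {set gT})%g%:R.

Lemma lcoset_mx_repr : mx_repr G lcoset_mx.
Proof.
split=> [|g h Gg Gh]; apply/matrixP=> i j; rewrite !mxE.
  by rewrite mul1g (inj_eq enum_val_inj).
have hjP : (h *: enum_val j)%g \in lcosets H G.
  have /lcosetsP[x Gx ->] := enum_valP j.
  apply/lcosetsP; exists (h * x)%g; first exact: groupM.
  by rewrite mulgA mulg_set1.
rewrite (bigD1 (enum_rank_in hjP (h *: enum_val j)%g)) //= big1 => [|k ne_k].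
  by rewrite !mxE enum_rankK_in // eqxx mulr1 addr0 mulgA mulg_set1.
rewrite !mxE; case: eqP => [_|_]; last by rewrite mul0r.
case: eqP => [eq_k|_]; last by rewrite mulr0.
by case/eqP: ne_k; apply: enum_val_inj; rewrite enum_rankK_in.
Qed.

Definition lcoset_repr : mx_representation algC G #|lcosets H G| :=
  MxRepresentation lcoset_mx_repr.

End CosetRepresentation.

(* Main.v *)
Require Import Defs.
From mathcomp Require Import all_boot all_order all_algebra.
From mathcomp Require Import all_fingroup all_solvable all_field all_character.

Set Implicit Arguments.
Unset Strict Implicit.
Unset Printing Implicit Defensive.

Import GRing.Theory Num.Theory.
Local Open Scope ring_scope.

(** Double counting the pairs (x, c) with c in C, x in a left coset A and
    x c^-1 in S gives the linear system  sum_(s in S) |C :&: s^-1 A| = |H|,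
    whose matrix M is the action of the class sum of S on the left cosets.
    As M is central, Schur's lemma makes it scalar on each simple submodule,
    the scalar being the sum that is assumed to be nonzero; hence M is
    invertible, and the constant vector |H|/|S| is the only solution. *)

Section CentralElementAction.

Variables (gT : finGroupType) (G : {group gT}) (n : nat).
Variable rG : mx_representation algC G n.

(** By linearity from the case of a group element, [val_submodJ]. It transports the action of a
    group ring element on a submodule to the ambient space. *)
Lemma val_submod_gring_op (U : 'M_n) (Umod : mxmodule rG U)
    (A : 'M[algC]_#|G|) m (W : 'M_(m, \rank U)) :
    (A \in group_ring algC G)%MS ->
  val_submod (W *m gring_op (submod_repr Umod) A)
    = val_submod W *m gring_op rG A.
Proof.
case/envelop_mxP=> a ->; rewrite !linear_sum /=.
apply: eq_bigr => x Gx; rewrite !linearZ /= !gring_opG //.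
by rewrite (val_submodJ Umod).
Qed.

Lemma gring_op_centgmx (A : 'M[algC]_#|G|) :
  (A \in 'Z(group_ring algC G))%MS -> centgmx rG (gring_op rG A).
Proof.
case/center_mxP=> RA cA; apply/centgmxP=> x Gx.
have Rx: (regular_repr algC G x \in group_ring algC G)%MS by apply: envelop_mx_id.
by rewrite -(gring_opG rG Gx) -!gring_opM // cA.
Qed.

(** Traces add up over a submodule and its quotient, so removing ['chi_i] from the character of [rG]
    leaves the character of the quotient. *)
Lemma irr_constt_submod (U : 'M_n) (Umod : mxmodule rG U) (i : Iirr G) :
  cfRepr (submod_repr Umod) = 'chi_i -> i \in irr_constt (cfRepr rG).
Proof.
move=> chiU; have ->: cfRepr rG = 'chi_i + cfRepr (factmod_repr Umod).
  apply/cfun_inP=> x Gx; rewrite -chiU !cfunE Gx.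
  by rewrite !mulr1n -(mxtrace_sub_fact_mod Umod).
apply/constt_charP; first by rewrite rpredD ?irr_char ?cfRepr_char.
by exists (cfRepr (factmod_repr Umod)); rewrite ?cfRepr_char.
Qed.

(** The kernel of a central element is a submodule. If it were nonzero it would contain a simple
    submodule, on which [A] acts both as zero and as a nonzero scalar ['omega_i[A]]. *)
Lemma gring_op_unitmx (A : 'M[algC]_#|G|) :
    (A \in 'Z(group_ring algC G))%MS ->
    {in irr_constt (cfRepr rG), forall i, 'omega_i[A] != 0} ->
  gring_op rG A \in unitmx.
Proof.
move=> ZA nz_omega; have [RA _] := center_mxP ZA.
rewrite -row_free_unit -kermx_eq0; apply: contraT => nzK.
have modK := kermx_centg_module (gring_op_centgmx ZA).
apply: (mxsimple_exists modK nzK) => [[U simU sUK]].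
have [modU nzU _] := simU.
have /irrP[i chi_i]: cfRepr (submod_repr modU) \in irr G.
  apply/irr_reprP; exists (Representation (submod_repr modU)) => //=.
  exact/submod_mx_irr.
have /negP[] := nz_omega i (irr_constt_submod chi_i).
have /eqP := val_submod_gring_op modU 1%:M RA.
(* Schur's lemma: [A] acts on [U] as the scalar ['omega_i[A]]. *)
rewrite (cfRepr_gring_center chi_i ZA) mul1mx.
have /sub_kermxP->: (val_submod (1%:M : 'M_(\rank U)) <= kermx (gring_op rG A))%MS.
  by rewrite val_submod1.
(* As the scalar is nonzero, the identity matrix of size [\rank U] would have to vanish, although
   [U] is nonzero. *)
rewrite val_submod_eq0 -scalemx1 scaler_eq0 => /orP[//|].
by rewrite -mxrank_eq0 mxrank1 mxrank_eq0 (negPf nzU).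
Qed.

End CentralElementAction.

Section ClassUnions.

Variables (gT : finGroupType) (G : {group gT}) (S : {set gT}).
Hypothesis S_classes : union_of_classes G S.

Lemma union_of_classes_sub : S \subset G.
Proof.
have [P /subsetP sPG ->] := S_classes; apply/bigcupsP=> K /sPG.
by case/imsetP=> x Gx ->; apply: class_subG.
Qed.

Lemma class_sub_union x : x \in S -> (x ^: G)%g \subset S.
Proof.
have [P /subsetP sPG ->] := S_classes.
case/bigcupP=> K PK Kx; have /imsetP[y _ defK] := sPG _ PK.
have /class_eqP->: x \in (y ^: G)%g by rewrite -defK.
by rewrite -defK bigcup_sup.
Qed.

(** Sorting the elements of [S] by their class loses nothing, since the class of any element of [S]
    lies inside [S]. *)
Lemma gset_mx_classes (F : fieldType) :
  gset_mx F G S = \sum_(K in classes G | K \subset S) gset_mx F G K.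
Proof.
have SG := subsetP union_of_classes_sub.
rewrite /gset_mx (partition_big (fun x => x ^: G)%g
  (fun K => (K \in classes G) && (K \subset S))) /= => [|x Sx]; last first.
  by rewrite mem_classes ?SG // class_sub_union.
apply: eq_bigr => K /andP[/imsetP[y Gy ->] /subsetP sKS].
apply: eq_bigl => x; apply/andP/idP=> [[Sx /eqP <-] | yx].
  by rewrite class_refl.
by rewrite sKS //; split=> //; apply/eqP/class_eqP.
Qed.

Lemma gset_mx_class_central (K : {set gT}) :
  K \in classes G -> (gset_mx algC G K \in 'Z(group_ring algC G))%MS.
Proof.
move=> GK; have := gring_class_sum_central algC (enum_rank_in GK K).
by rewrite /gring_class_sum enum_rankK_in.
Qed.

Lemma gset_mx_union_central : (gset_mx algC G S \in 'Z(group_ring algC G))%MS.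
Proof.
rewrite gset_mx_classes linear_sum summx_sub // => K /andP[GK _].
exact: gset_mx_class_central.
Qed.

(** The central character is additive and known on class sums; this identifies the sum in the
    hypothesis of the theorem as the Schur scalar. *)
Lemma gring_mode_union (i : Iirr G) :
  'omega_i[gset_mx algC G S] =
    \sum_(K in classes G | K \subset S)
       #|K|%:R * 'chi_i (repr K) / 'chi_i 1%g.
Proof.
rewrite gset_mx_classes raddf_sum /=; apply: eq_bigr => K /andP[GK _].
have [_ defK] := repr_classesP GK.
have := @gring_mode_class_sum_eq _ _ i (enum_rank_in GK K) (repr K).
rewrite /gring_class_sum enum_rankK_in // -defK; apply.
by rewrite {2}defK class_refl.
Qed.

End ClassUnions.

Section TotalPerfectCodes.

Variables (gT : finGroupType) (G H : {group gT}) (S : {set gT}).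

Lemma total_perfect_code_count (C A : {set gT}) :
    total_perfect_code G (cayley S) C -> A \subset G ->
  (\sum_(s in S) #|C :&: (s^-1 *: A)%g|)%N = #|A|.
Proof.
case=> _ codeC /subsetP sAG.
transitivity (\sum_(x in A) \sum_(c in C | cayley S x c) 1)%N; last first.
  rewrite -sum1_card; apply: eq_bigr => x Ax.
  by rewrite sum1dep_card codeC ?sAG.
transitivity (\sum_(s in S) \sum_(c in C | (s * c)%g \in A) 1)%N.
  apply: eq_bigr => s _; rewrite -sum1_card; apply: eq_bigl => c.
  by rewrite inE mem_lcoset invgK.
rewrite (exchange_big_dep (mem C)) /= => [|s c _ /andP[] //].
rewrite [RHS](exchange_big_dep (mem C)) /= => [|s c _ /andP[] //].
(* For fixed [c], the substitution x = s c matches the s in [S] with s c in [A] to the x in [A]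
   adjacent to [c]. *)
apply: eq_bigr => c Cc; rewrite [RHS](reindex_inj (mulIg c)) /=.
by apply: eq_bigl => s; rewrite Cc /cayley mulgK andbC.
Qed.

Lemma lcosets_actG (g : gT) (A : {set gT}) :
  g \in G -> A \in lcosets H G -> (g *: A)%g \in lcosets H G.
Proof.
move=> Gg /lcosetsP[x Gx ->]; apply/lcosetsP; exists (g * x)%g.
  exact: groupM.
by rewrite mulgA mulg_set1.
Qed.

Lemma lcoset_mx_col (g : gT) (f : {set gT} -> algC) : g \in G ->
  lcoset_mx G H g *m \col_j f (enum_val j) = \col_i f (g^-1 *: enum_val i)%g.
Proof.
move=> Gg; apply/colP=> i; rewrite !mxE.
have giP := lcosets_actG (groupVr Gg) (enum_valP i).
(* Row i has a single nonzero entry, in the column of the coset [g^-1 *: enum_val i]. *)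
rewrite (bigD1 (enum_rank_in giP (g^-1 *: enum_val i)%g)) //= big1 => [|k ne_k].
  by rewrite !mxE enum_rankK_in // mulgA mulg_set1 mulgV mul1g eqxx mul1r addr0.
rewrite !mxE; case: eqP => [eq_k|_]; last by rewrite mul0r.
case/eqP: ne_k; apply: enum_val_inj; rewrite enum_rankK_in //.
by rewrite eq_k mulgA mulg_set1 mulVg mul1g.
Qed.

Lemma gring_op_gset_mx n (rG : mx_representation algC G n) :
  S \subset G -> gring_op rG (gset_mx algC G S) = \sum_(s in S) rG s.
Proof.
move=> /subsetP sSG; rewrite linear_sum; apply: eq_bigr => s /sSG Gs.
exact: gring_opG.
Qed.

(** The product form in natural numbers yields both the quotient formula and the divisibility
    obstruction. *)
Lemma total_perfect_code_lcoset (C A : {set gT}) :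
    union_of_classes G S -> H \subset G ->
    (forall i : Iirr G, i \in irr_constt (cfRepr (lcoset_repr G H)) ->
       \sum_(K in classes G | K \subset S)
          #|K|%:R * 'chi_i (repr K) / 'chi_i 1%g != 0) ->
    total_perfect_code G (cayley S) C -> A \in lcosets H G ->
  (#|C :&: A| * #|S|)%N = #|H|.
Proof.
move=> clS sHG nz codeC lA; have sSG := union_of_classes_sub clS.
pose M := gring_op (lcoset_repr G H) (gset_mx algC G S).
have unitM: M \in unitmx.
  apply: gring_op_unitmx (gset_mx_union_central clS) _ => i /nz.
  by rewrite gring_mode_union.
(* The deviation from the expected constant solution, multiplied by [#|S|] to avoid division; it
   solves the homogeneous system. *)
pose f (B : {set gT}) : algC := (#|C :&: B| * #|S|)%:R - #|H|%:R.
have Mf0: M *m \col_j f (enum_val j) = 0.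
  rewrite /M gring_op_gset_mx // mulmx_suml.
  rewrite (eq_bigr (fun s => \col_i f (s^-1 *: enum_val i)%g)) => [|s Ss];
    last by rewrite lcoset_mx_col ?(subsetP sSG).
  apply/colP=> i; rewrite summxE mxE.
  rewrite (eq_bigr (fun s => f (s^-1 *: enum_val i)%g)) => [|s _];
    last by rewrite mxE.
  have /lcosetsP[x Gx ->] := enum_valP i.
  rewrite sumrB sumr_const -natr_sum -big_distrl /=.
  rewrite total_perfect_code_count ?card_lcoset ?natrM ?mulr_natr ?subrr //.
  by rewrite -(lcoset_id Gx) mulgS.
have f0: \col_j f (enum_val j) = 0 :> 'cV_#|lcosets H G|.
  by rewrite -(mulKmx unitM (\col_j _)) Mf0 mulmx0.
have /eqP := congr1 (fun u : 'cV_#|lcosets H G| => u (enum_rank_in lA A) 0) f0.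
by rewrite !mxE enum_rankK_in // subr_eq0 eqr_nat => /eqP.
Qed.

End TotalPerfectCodes.

Theorem theorem5p10 (gT : finGroupType) (G H : {group gT}) (S : {set gT})
    (S_classes : union_of_classes G S)
    (S_not1 : 1%g \notin S)
    (S_sym : (S^-1)%g = S)
    (sHG : H \subset G)
    (sum_neq0 : forall i : Iirr G,
       i \in irr_constt (cfRepr (lcoset_repr G H)) ->
       \sum_(K in classes G | K \subset S)
          #|K|%:R * 'chi_i (repr K) / 'chi_i 1%g != 0) :
  (forall C : {set gT}, total_perfect_code G (cayley S) C ->
     forall A : {set gT}, A \in lcosets H G ->
       #|C :&: A|%:R = #|H|%:R / #|S|%:R :> rat)
  /\
  (~~ (#|S| %| #|H|)%N ->
     ~ exists C : {set gT}, total_perfect_code G (cayley S) C).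
Proof.
split=> [C codeC A lA | ndvd [C codeC]].
  have defH := total_perfect_code_lcoset S_classes sHG sum_neq0 codeC lA.
  (* Existence of a code forces [S] to be nonempty, so the quotient by [#|S|] is a genuine one. *)
  have S_gt0: (0 < #|S|)%N.
    by move: (cardG_gt0 H); rewrite -defH muln_gt0 => /andP[].
  by rewrite -defH natrM mulfK // pnatr_eq0 -lt0n.
(* The trivial coset [H] already shows that [#|S|] divides [#|H|]. *)
have lH: (H : {set gT}) \in lcosets H G by apply/lcosetsP; exists 1%g; rewrite ?mul1g.
have defH := total_perfect_code_lcoset S_classes sHG sum_neq0 codeC lH.
by rewrite -defH dvdn_mull in ndvd.
Qed.
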